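(* Let $A,B\in\mathbb{R}^{n\times n}$ be symmetric and positive definite, and define $W=B^{-1}(B-A)$. Assume that $B\succeq A$ or $B\preceq A$. Then for any vector $s\in\mathbb{R}^n$ satisfying $Ws\ne0$, $$\frac{\|A^{-1/2}(B-A)s\|_2^2}{\|A^{1/2}s\|_2^2}\le\frac{\|A^{-1/2}(B-A)Ws\|_2^2}{\|A^{1/2}Ws\|_2^2},$$ with equality if and only if $s$ is an eigenvector of $W$.
   Context: $\succeq,\preceq$ denote the Loewner order on symmetric matrices: $B\succeq A$ means $B-A$ is positive semidefinite. $A^{1/2}$ is the symmetric positive definite square root of $A$ and $A^{-1/2}$ its inverse. *)

(* Defs.v *)
From mathcomp Require Import all_boot all_order all_algebra.
From mathcomp Require Import boolp classical_sets reals.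
Set Implicit Arguments.
Unset Strict Implicit.
Unset Printing Implicit Defensive.
Import Order.TTheory GRing.Theory Num.Theory.
Local Open Scope classical_set_scope.
Local Open Scope ring_scope.

Definition norm2 (R : realType) (n : nat) (v : 'cV[R]_n) : R :=
  Num.sqrt (\sum_(i < n) v i 0 ^+ 2).

Definition quadform (R : realType) (n : nat) (A : 'M[R]_n) (v : 'cV[R]_n) : R :=
  (v^T *m A *m v) 0 0.

Definition sympsd (R : realType) (n : nat) (A : 'M[R]_n) : Prop :=
  A \is symmetricmx /\ forall v : 'cV[R]_n, 0 <= quadform A v.

Definition sympd (R : realType) (n : nat) (A : 'M[R]_n) : Prop :=
  A \is symmetricmx /\ forall v : 'cV[R]_n, v != 0 -> 0 < quadform A v.

Definition loewner_le (R : realType) (n : nat) (A B : 'M[R]_n) : Prop :=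
  sympsd (B - A).

(* When A is symmetric positive definite the set below is a singleton, so the
   default value A of xget is only reached for other A. *)
Definition sqrtmx (R : realType) (n : nat) (A : 'M[R]_n) : 'M[R]_n :=
  xget A [set S : 'M[R]_n | sympd S /\ S *m S = A].

(* The matrix acts on column vectors, unlike in mxalgebra's eigenspace, which
   collects row (i.e. left) eigenvectors. *)
Definition is_eigenvector (R : realType) (n : nat) (W : 'M[R]_n)
    (s : 'cV[R]_n) : Prop :=
  s != 0 /\ exists a : R, W *m s = a *: s.

(* Main.v *)
(* A real symmetric matrix is orthogonally diagonalizable: it has a real
   eigenvalue because its complexification is Hermitian, and a Householder
   reflection splits off the eigenvector. This gives square roots of positive
   definite matrices, and an invertible P with B = P^T P and
   B - A = P^T diag(d) P, hence W = P^-1 diag(d) P. With t = P s the two sides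
   of the inequality are
     (sum d^2/(1-d) t^2) / (sum (1-d) t^2)  and
     (sum d^2/(1-d) (d t)^2) / (sum (1-d) (d t)^2).
   Here d < 1 because A is positive definite, and all entries of d have the same
   sign by the Loewner comparison of A and B, so the claim is an instance of
   Chebyshev's sum inequality. *)
Require Import Defs.
From mathcomp Require Import all_boot all_order all_algebra.
From mathcomp Require Import boolp classical_sets reals.
From mathcomp Require Import complex ring.
Import Order.TTheory GRing.Theory Num.Theory.
Local Open Scope ring_scope.

Set Implicit Arguments.
Unset Strict Implicit.

(** * Symmetric matrices: real eigenvalues, Householder reflections, spectral theorem *)

Lemma symmetricmxP (R : fieldType) n (M : 'M[R]_n) :
  M^T = M <-> M \is symmetricmx.
Proof.
rewrite is_hermitianmxE expr0 scale1r map_mx_id //.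
by split=> [->|/eqP].
Qed.

Lemma symmetric_eigenvalue (R : rcfType) n (M : 'M[R]_n) :
  (0 < n)%N -> M^T = M -> exists a, eigenvalue M a.
Proof.
move=> n_gt0 Msym; pose Mc := map_mx (real_complex R) M.
have hermMc : Mc \is hermsymmx.
  apply: realsym_hermsym.
    by apply/symmetricmxP; rewrite /Mc map_trmx Msym.
  by apply/mxOverP => i j; rewrite mxE /= complex_real.
have /orthomx_spectralP Mc_eq := hermitian_normalmx hermMc.
pose z := spectral_diag Mc 0 (Ordinal n_gt0).
have zreal : z \is Num.real.
  exact: (mxOverP (hermitian_spectral_diag_real hermMc)).
have Pu := spectral_unit Mc.
exists (complex.Re z).
(* Eigenvalues are the roots of the characteristic polynomial, and being a root can be tested after
   embedding [R] into its complex numbers, where a row of the unitary spectral matrix is an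
   eigenvector for [z]. *)
rewrite eigenvalue_root_char -(fmorph_root (real_complex R)) map_char_poly.
rewrite -eigenvalue_root_char.
have zE : real_complex R (complex.Re z) = z by exact: RRe_real.
rewrite [X in eigenvalue _ X]zE.
apply/eigenvalueP; exists (row (Ordinal n_gt0) (spectralmx Mc)).
  rewrite -row_mul -/Mc {2}Mc_eq !mulmxA mulmxV // mul1mx.
  by rewrite row_mul row_diag_mx -scalemxAl -rowE.
rewrite rowE; apply/eqP => /(congr1 (mulmxr (invmx (spectralmx Mc)))) /=.
rewrite mulmxK // mul0mx => /rowP/(_ (Ordinal n_gt0))/eqP.
by rewrite !mxE !eqxx oner_eq0.
Qed.

Lemma mulmx_tr_ge0 (R : realFieldType) n (v : 'rV[R]_n) : 0 <= (v *m v^T) 0 0.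
Proof. by rewrite mxE sumr_ge0 // => i _; rewrite mxE -expr2 sqr_ge0. Qed.

Lemma mulmx_tr_eq0 (R : realFieldType) n (v : 'rV[R]_n) :
  (v *m v^T) 0 0 = 0 -> v = 0.
Proof.
move=> /eqP; rewrite mxE psumr_eq0 => [/allP v0|i _].
  apply/rowP => i; have := v0 i (mem_index_enum _).
  by rewrite /= !mxE mulf_eq0 orbb => /eqP.
by rewrite mxE -expr2 sqr_ge0.
Qed.

(* The witness is the reflection exchanging [v] and the first basis vector. *)
Lemma householder (R : realFieldType) n (v : 'rV[R]_n.+1) :
  v *m v^T = 1%:M ->
  exists H : 'M[R]_n.+1, H *m H^T = 1%:M /\ delta_mx 0 0 *m H = v.
Proof.
move=> vv; pose e : 'rV[R]_n.+1 := delta_mx 0 0.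
have [->|v_neq_e] := eqVneq v e.
  by exists 1%:M; rewrite trmx1 !mulmx1.
pose u := v - e; pose c := (u *m u^T) 0 0; pose k := 2 / c.
have ee : e *m e^T = 1%:M.
  by rewrite trmx_delta mul_delta_mx; apply/matrixP=> i j; rewrite !ord1 !mxE.
have uuE : u *m u^T = c%:M by rewrite [LHS]mx11_scalar.
have c_neq0 : c != 0.
  apply: contra_neq v_neq_e => c0; apply/eqP; rewrite -subr_eq0 -/u.
  by apply/eqP/mulmx_tr_eq0.
(* As [v] and [e] are unit vectors, both sides are 2 - 2<e,v>. Hence reflecting [e] along [u], which
   subtracts 2<e,u>/c times [u], yields [e + u = v]. *)
have eu : - (2 *: (e *m u^T)) = c%:M.
  rewrite -uuE /u raddfB /= !mulmxBl !mulmxBr vv ee.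
  have -> : v *m e^T = e *m v^T.
    by rewrite [RHS]mx11_scalar -tr_scalar_mx -mx11_scalar trmx_mul trmxK.
  by rewrite scaler_nat mulr2n opprD !opprB.
have euv : e + u = v by exact: subrKC.
clearbody u.
pose H := 1%:M - k *: (u^T *m u).
have HT : H^T = H by rewrite /H raddfB /= trmx1 linearZ /= trmx_mul trmxK.
exists H; rewrite HT; split.
  have UU : (u^T *m u) *m (u^T *m u) = c *: (u^T *m u).
    by rewrite mulmxA -(mulmxA u^T u) uuE mul_mx_scalar -scalemxAl.
  rewrite /H mulmxBl !mulmxBr !mulmx1 mul1mx -scalemxAl -scalemxAr UU !scalerA.
  have -> : k * k * c = k + k by rewrite /k; field.
  rewrite opprB scalerDl.
  by rewrite addrK subrK.
have eu' : e *m u^T = - (c / 2)%:M.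
  have: 2 *: (e *m u^T) = - c%:M by rewrite -eu opprK.
  move=> /(congr1 (fun x => 2^-1 *: x)).
  rewrite scalerA mulVf ?pnatr_eq0 // scale1r => ->.
  by rewrite scalerN scale_scalar_mx mulrC.
rewrite mulmxBr mulmx1 -scalemxAr mulmxA eu' mulNmx mul_scalar_mx scalerN.
rewrite opprK scalerA.
by rewrite (_ : k * _ = 1) ?scale1r // /k; field.
Qed.

(** Induction on the size. Conjugating by a reflection that sends the first basis vector to a unit
    eigenvector makes the first row of [N] equal to (a, 0, ..., 0); symmetry clears the first column
    as well, and the remaining diagonal block is symmetric. *)
Lemma spectral_theorem (R : rcfType) n (M : 'M[R]_n) : M^T = M ->
  exists (Q : 'M[R]_n) (d : 'rV[R]_n),
    Q *m Q^T = 1%:M /\ M = Q^T *m diag_mx d *m Q.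
Proof.
elim: n M => [|n IHn] M Msym.
  by exists 1%:M, 0; split; apply/matrixP => - [].
have [a /eigenvalueP[w wM w_neq0]] := symmetric_eigenvalue (ltn0Sn n) Msym.
pose c := (w *m w^T) 0 0.
have c_gt0 : 0 < c.
  rewrite lt0r mulmx_tr_ge0 andbT.
  by apply: contra_neq w_neq0; apply: mulmx_tr_eq0.
pose v := (Num.sqrt c)^-1 *: w.
have vM : v *m M = a *: v by rewrite -scalemxAl wM !scalerA mulrC.
have /householder[H [HH eH]] : v *m v^T = 1%:M.
  rewrite linearZ /= -scalemxAl -scalemxAr scalerA -invfM -expr2.
  rewrite sqr_sqrtr ?ltW //.
  by rewrite [_ *m _]mx11_scalar -/c scale_scalar_mx mulVf ?gt_eqF.
pose N : 'M_(1 + n) := H *m M *m H^T.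
have Nsym : N^T = N by rewrite /N !trmx_mul trmxK Msym mulmxA.
have eN : delta_mx 0 0 *m N = a *: delta_mx 0 0 :> 'rV_(1 + n).
  by rewrite /N !mulmxA eH vM -eH -scalemxAl -mulmxA HH mulmx1.
have HTH := mulmx1C HH.
have ME : M = H^T *m N *m H.
  by rewrite /N !mulmxA HTH mul1mx -mulmxA HTH mulmx1.
clearbody N.
have N0 j : N 0 j = a * (j == 0)%:R.
  by have /rowP/(_ j) := eN; rewrite -rowE !mxE.
have l0 : lshift n 0 = 0 :> 'I_(1 + n) by exact: val_inj.
have ur0 : ursubmx N = 0.
  apply/matrixP => i j; rewrite !mxE ord1.
  by rewrite l0 N0 mulr0.
have ul : ulsubmx N = a%:M.
  apply/matrixP => i j; rewrite !mxE !ord1.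
  by rewrite l0 N0 mulr1.
have dl0 : dlsubmx N = 0 by rewrite -Nsym -trmx_ursub ur0 trmx0.
have [|Q [d [QQ Nd]]] := IHn (drsubmx N); first by rewrite trmx_drsub Nsym.
pose K : 'M_(1 + n) := block_mx 1%:M 0 0 Q.
exists (K *m H), (row_mx a%:M d).
have KT : K^T = block_mx 1%:M 0 0 Q^T by rewrite /K tr_block_mx trmx1 !trmx0.
have KK : K *m K^T = 1%:M.
  rewrite KT mulmx_block !mulmx0 !mul0mx !addr0 add0r mulmx1 QQ.
  by rewrite -scalar_mx_block.
split.
  by rewrite trmx_mul !mulmxA -(mulmxA K) HH mulmx1 KK.
have dE := diag_mx_row (a%:M : 'rV_1) d.
rewrite {1}ME -[N]submxK ur0 ul dl0 Nd dE.
rewrite (_ : block_mx _ _ _ _ =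
    K^T *m block_mx (diag_mx a%:M) 0 0 (diag_mx d) *m K).
  by rewrite trmx_mul !mulmxA.
rewrite KT !mulmx_block !mulmx0 !mul0mx !addr0 !add0r mulmx1 mul1mx.
rewrite mul0mx mul0mx; congr block_mx.
by apply/matrixP => i j; rewrite !ord1 !mxE.
Qed.

(** * Norms and quadratic forms under congruence *)

Lemma norm2_sqr (R : realType) n (v : 'cV[R]_n) : norm2 v ^+ 2 = (v^T *m v) 0 0.
Proof.
rewrite /norm2 sqr_sqrtr ?sumr_ge0 // => [|i _]; last exact: sqr_ge0.
by rewrite mxE; apply: eq_bigr => i _; rewrite mxE expr2.
Qed.

Lemma quadform_diag (R : realType) n (d : 'rV[R]_n) (v : 'cV[R]_n) :
  quadform (diag_mx d) v = \sum_i d 0 i * v i 0 ^+ 2.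
Proof.
rewrite /quadform -mulmxA mxE; apply: eq_bigr => i _.
by rewrite mul_diag_mx !mxE mulrCA expr2.
Qed.

Lemma quadform_congr (R : realType) n (P M : 'M[R]_n) (v : 'cV[R]_n) :
  quadform (P^T *m M *m P) v = quadform M (P *m v).
Proof. by rewrite /quadform trmx_mul !mulmxA. Qed.

(** Turns a sign condition on a quadratic form into one on each diagonal entry. *)
Lemma quadform_congr_delta (R : realType) n (P : 'M[R]_n) (d : 'rV[R]_n) i :
  P \in unitmx ->
  quadform (P^T *m diag_mx d *m P) (invmx P *m delta_mx i 0) = d 0 i.
Proof.
move=> Pu; rewrite quadform_congr mulKVmx // quadform_diag (bigD1 i) //=.
rewrite big1 => [|j /negbTE ji]; last by rewrite mxE ji /= expr0n mulr0.
by rewrite mxE !eqxx expr1n mulr1 addr0.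
Qed.

Lemma congr_delta_neq0 (R : realType) n (P : 'M[R]_n) i :
  P \in unitmx -> invmx P *m (delta_mx i 0 : 'cV_n) != 0.
Proof.
move=> Pu; apply/eqP => /(congr1 (mulmx P)); rewrite mulKVmx // mulmx0.
by move=> /colP/(_ i)/eqP; rewrite !mxE !eqxx oner_eq0.
Qed.

(** * Positive definite matrices: square roots and simultaneous diagonalization *)

Lemma sympd_unitmx (R : realType) n (A : 'M[R]_n) : sympd A -> A \in unitmx.
Proof.
move=> [_ Apos]; rewrite -row_free_unit; apply: inj_row_free => v vA.
apply/eqP; apply: contraFT (ltxx (0 : R)) => v_neq0.
have := Apos v^T; rewrite /quadform trmxK vA mul0mx mxE.
by apply; rewrite trmx_eq0.
Qed.

Lemma sympd_sqrtmx (R : realType) n (A : 'M[R]_n) :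
  sympd A -> sympd (sqrtmx A) /\ sqrtmx A *m sqrtmx A = A.
Proof.
move=> [/symmetricmxP Asym Apos].
(* [xget] returns an element of the set as soon as there is one, so it suffices to exhibit a root:
   take square roots of the eigenvalues. *)
suff: exists S : 'M[R]_n, sympd S /\ S *m S = A by exact: xgetPex.
have [Q [d [QQ AE]]] := spectral_theorem Asym.
have [Qu _] := mulmx1_unit QQ.
have d_gt0 i : 0 < d 0 i.
  by rewrite -(quadform_congr_delta d i Qu) -AE Apos // congr_delta_neq0.
pose r := \row_i Num.sqrt (d 0 i).
exists (Q^T *m diag_mx r *m Q); split; last first.
  rewrite [RHS]AE !mulmxA -(mulmxA _ Q Q^T) QQ mulmx1 -!mulmxA; congr (_ *m _).
  rewrite !mulmxA mulmx_diag; congr (diag_mx _ *m _).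
  by apply/rowP => i; rewrite !mxE -expr2 sqr_sqrtr // ltW.
split; first by apply/symmetricmxP; rewrite !trmx_mul trmxK tr_diag_mx mulmxA.
move=> v v_neq0; rewrite quadform_congr quadform_diag.
have r_gt0 i : 0 < r 0 i by rewrite mxE sqrtr_gt0.
have ge0 i : true -> 0 <= r 0 i * (Q *m v) i 0 ^+ 2.
  by rewrite mulr_ge0 ?sqr_ge0 ?ltW.
rewrite lt0r sumr_ge0 // andbT; apply: contra_neq v_neq0 => /eqP.
rewrite psumr_eq0 // => /allP Qv0; rewrite -(mulKmx Qu v).
rewrite (_ : Q *m v = 0) ?mulmx0 //; apply/colP => i.
have := Qv0 i (mem_index_enum _).
by rewrite /= mulf_eq0 gt_eqF //= sqrf_eq0 => /eqP ->; rewrite mxE.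
Qed.

(** With T the square root of B, the matrix T^-1 D T^-1 is symmetric. If Q diagonalizes it
    orthogonally, then P = Q T diagonalizes D by congruence, while P^T P = T Q^T Q T = B. *)
Lemma simultaneous_diagonalization (R : realType) n (B D : 'M[R]_n) :
  sympd B -> D^T = D ->
  exists (P : 'M[R]_n) (d : 'rV[R]_n),
    [/\ P \in unitmx, B = P^T *m P & D = P^T *m diag_mx d *m P].
Proof.
move=> /sympd_sqrtmx[Tpd TT] Dsym; set T := sqrtmx B in Tpd TT.
have Tu := sympd_unitmx Tpd.
have /symmetricmxP Tsym := Tpd.1.
have [|Q [d [QQ DE]]] := @spectral_theorem _ _ (invmx T *m D *m invmx T).
  by rewrite !trmx_mul trmx_inv Tsym Dsym mulmxA.
exists (Q *m T), d; split.
- by rewrite unitmx_mul Tu andbT; have [] := mulmx1_unit QQ.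
- by rewrite trmx_mul mulmxA -(mulmxA _ Q^T) (mulmx1C QQ) mulmx1 Tsym TT.
- rewrite trmx_mul Tsym !mulmxA -2!(mulmxA T) -DE !mulmxA mulmxV // mul1mx.
  by rewrite mulmxKV.
Qed.

(** * Chebyshev's sum inequality and its equality case *)

(** Expanding the product of differences gives two expressions that are swapped by exchanging [i]
    and [j]; this is the factor 2. *)
Lemma chebyshev_sum (R : realFieldType) n (w f g : 'I_n -> R) :
  2 * ((\sum_i w i * f i * g i) * (\sum_i w i)
       - (\sum_i w i * f i) * (\sum_i w i * g i)) =
  \sum_i \sum_j w i * w j * ((f i - f j) * (g i - g j)).
Proof.
transitivity (\sum_i \sum_j (w i * f i * g i * w j - w i * f i * (w j * g j)
   + (w j * f j * g j * w i - w j * f j * (w i * g i)))); last first.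
  by apply: eq_bigr => i _; apply: eq_bigr => j _; ring.
under [RHS]eq_bigr => i _ do rewrite big_split /=.
rewrite [RHS]big_split /= [X in _ = _ + X]exchange_big /=.
rewrite -[RHS]mulr2n -[RHS]mulr_natl.
congr (_ * _); rewrite !big_distrlr -sumrB; apply: eq_bigr => i _.
by rewrite -sumrB.
Qed.

(* Chebyshev's sum inequality with weights [(1 - l) t ^ 2], applied to
   [(l / (1 - l)) ^ 2] and [l ^ 2]: since the [l i] all have the same sign,
   these two functions are ordered in the same way. *)
Lemma ratio_ineq (R : realFieldType) n (l t : 'I_n -> R) :
  (forall i, l i < 1) ->
  ((forall i, 0 <= l i) \/ (forall i, l i <= 0)) ->
  (exists i, l i * t i != 0) ->
  let lhs := (\sum_i l i ^+ 2 / (1 - l i) * t i ^+ 2)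
             / (\sum_i (1 - l i) * t i ^+ 2) in
  let rhs := (\sum_i l i ^+ 2 / (1 - l i) * (l i * t i) ^+ 2)
             / (\sum_i (1 - l i) * (l i * t i) ^+ 2) in
  lhs <= rhs /\ (lhs = rhs <-> exists a, forall i, l i * t i = a * t i).
Proof.
move=> l_lt1 l_sgn [k lt_neq0] /=.
have l1_gt0 i : 0 < 1 - l i by rewrite subr_gt0.
have l1_neq0 i : 1 - l i != 0 by rewrite gt_eqF.
have [lk_neq0 tk_neq0] : l k != 0 /\ t k != 0.
  by apply/andP; rewrite -negb_or -mulf_eq0.
pose w i := (1 - l i) * t i ^+ 2.
pose f i := (l i / (1 - l i)) ^+ 2.
pose g i := l i ^+ 2.
have w_ge0 i : 0 <= w i by rewrite mulr_ge0 ?sqr_ge0 ?ltW.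
have wk_gt0 : 0 < w k by rewrite mulr_gt0 // exprn_even_gt0.
have -> : \sum_i l i ^+ 2 / (1 - l i) * t i ^+ 2 = \sum_i w i * f i.
  by apply: eq_bigr => i _; rewrite /w /f; field.
have -> : \sum_i l i ^+ 2 / (1 - l i) * (l i * t i) ^+ 2 =
    \sum_i w i * f i * g i.
  by apply: eq_bigr => i _; rewrite /w /f /g; field.
have -> : \sum_i (1 - l i) * (l i * t i) ^+ 2 = \sum_i w i * g i.
  by apply: eq_bigr => i _; rewrite /w /g; ring.
rewrite (_ : \sum_i (1 - l i) * t i ^+ 2 = \sum_i w i) //.
have W_gt0 : 0 < \sum_i w i.
  by rewrite (bigD1 k) //= ltr_pwDl // sumr_ge0.
have G_gt0 : 0 < \sum_i w i * g i.
  rewrite (bigD1 k) //= ltr_pwDl //.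
    by rewrite mulr_gt0 // exprn_even_gt0.
  by rewrite sumr_ge0 // => i _; rewrite mulr_ge0 // sqr_ge0.
(* Isolates a square, so that the sign rests on two factors, each of which inherits the common sign
   of the [l i]. *)
have fgE i j : (f i - f j) * (g i - g j) =
    ((l i - l j) / ((1 - l i) * (1 - l j))) ^+ 2 *
    ((l i + l j) * (l i * (1 - l j) + l j * (1 - l i))).
  by rewrite /f /g; field; rewrite !l1_neq0.
have sgn_ge0 i j : 0 <= (l i + l j) * (l i * (1 - l j) + l j * (1 - l i)).
  case: l_sgn => ls.
    by rewrite mulr_ge0 ?addr_ge0 ?mulr_ge0 // ltW.
  have ln i' : 0 <= - l i' by rewrite oppr_ge0.
  by rewrite -mulrNN !opprD -!mulNr mulr_ge0 ?addr_ge0 ?mulr_ge0 // ltW.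
(* Strictness against the fixed index [k], where [l k] is nonzero; this drives the equality case. *)
have sgn_gt0 i :
   0 < (l k + l i) * (l k * (1 - l i) + l i * (1 - l k)).
  case: l_sgn => ls.
    have lk_gt0 : 0 < l k by rewrite lt0r lk_neq0 ls.
    by rewrite mulr_gt0 // ltr_pwDl // ?mulr_gt0 ?mulr_ge0 // ltW.
  have lk_lt0 : 0 < - l k by rewrite oppr_gt0 lt_neqAle lk_neq0 ls.
  have ln i' : 0 <= - l i' by rewrite oppr_ge0.
  rewrite -mulrNN !opprD -!mulNr.
  by rewrite mulr_gt0 // ltr_pwDl // ?mulr_gt0 ?mulr_ge0 // ltW.
have term_ge0 i j : 0 <= w i * w j * ((f i - f j) * (g i - g j)).
  by apply: mulr_ge0; [exact: mulr_ge0 | rewrite fgE mulr_ge0 ?sqr_ge0].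
have cheb := chebyshev_sum w f g.
have gap_ge0 : 0 <= \sum_i \sum_j w i * w j * ((f i - f j) * (g i - g j)).
  by rewrite sumr_ge0 // => i _; rewrite sumr_ge0.
split.
  rewrite ler_pdivrMr // mulrAC ler_pdivlMr // -subr_ge0.
  by rewrite -(pmulr_rge0 _ (ltr0Sn R 1)) cheb.
split=> [/eqP|[a la]].
  rewrite eqr_div ?lt0r_neq0 // => /eqP eqn.
  move: cheb; rewrite -eqn subrr mulr0 => /esym/eqP.
  rewrite psumr_eq0 => [|i _]; last by rewrite sumr_ge0.
  move=> /allP/(_ k (mem_index_enum _)) /=.
  rewrite psumr_eq0 // => /allP tk0.
  (* Equality makes every term of the double sum vanish. In the terms with first index [k], this
     forces [t i = 0] or [l i = l k]. *)
  exists (l k) => i; have := tk0 i (mem_index_enum _).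
  rewrite /= fgE mulf_eq0 mulf_eq0 gt_eqF //= mulf_eq0 sqrf_eq0.
  rewrite /w mulf_eq0 gt_eqF //= sqrf_eq0 => /orP[/eqP ->|].
    by rewrite !mulr0.
  have [-> //|li] := eqVneq (l i) (l k).
  rewrite (gt_eqF (sgn_gt0 _)) orbF mulf_eq0 invr_eq0 mulf_eq0.
  by rewrite !(negbTE (l1_neq0 _)) !orbF subr_eq0 eq_sym (negbTE li).
apply/eqP; rewrite eqr_div ?lt0r_neq0 // eq_sym -subr_eq0.
have two_neq0 : 2 != 0 :> R by rewrite pnatr_eq0.
apply/eqP/(mulfI two_neq0); rewrite cheb mulr0.
(* Conversely [l] is constant on the support of [t], so each term has a zero weight or a zero
   difference. *)
have {}la i : t i != 0 -> l i = a by move=> ti; apply: (mulIf ti).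
apply: big1 => i _; apply: big1 => j _.
have [ti0|/la li] := eqVneq (t i) 0.
  by rewrite /w ti0 expr0n /= mulr0 !mul0r.
have [tj0|/la lj] := eqVneq (t j) 0.
  by rewrite /w tj0 expr0n /= !mulr0 !mul0r.
by rewrite /g li lj subrr !mulr0.
Qed.

(** * Reduction of the matrix statement to the scalar inequality *)

Unset Implicit Arguments.
Set Strict Implicit.

Theorem theorem3p11 (R : realType) (n : nat) (A B : 'M[R]_n)
    (hA : sympd A) (hB : sympd B)
    (hAB : loewner_le A B \/ loewner_le B A) (s : 'cV[R]_n) :
  let W := invmx B *m (B - A) in
  let rootA := sqrtmx A in
  let lhs := norm2 (invmx rootA *m (B - A) *m s) ^+ 2
             / norm2 (rootA *m s) ^+ 2 in
  let rhs := norm2 (invmx rootA *m (B - A) *m W *m s) ^+ 2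
             / norm2 (rootA *m W *m s) ^+ 2 in
  W *m s != 0 ->
  lhs <= rhs /\ (lhs = rhs <-> is_eigenvector W s).
Proof.
move=> W S.
have /symmetricmxP Asym := hA.1; have /symmetricmxP Bsym := hB.1.
have [|P [d [Pu BE DE]]] := @simultaneous_diagonalization _ _ _ (B - A) hB.
  by rewrite linearB /= Asym Bsym.
have [Spd SS] : sympd S /\ S *m S = A := sympd_sqrtmx hA.
have Su := sympd_unitmx Spd; have /symmetricmxP Ssym := Spd.1.
have PTu : P^T \in unitmx by rewrite unitmx_tr.
(* A = B - (B - A), and B becomes the identity in the coordinates given by [P]. *)
pose e := \row_i (1 - d 0 i).
have AE : A = P^T *m diag_mx e *m P.
  rewrite -[LHS](subKr B) DE {1}BE -{1}[P^T]mulmx1.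
  rewrite -mulmxBl -mulmxBr -diag_const_mx -raddfB; congr (_ *m diag_mx _ *m _).
  by apply/rowP => i; rewrite !mxE.
have e_gt0 i : 0 < 1 - d 0 i.
  have := hA.2 _ (congr_delta_neq0 i Pu).
  by rewrite AE quadform_congr_delta // mxE.
have d_sgn : (forall i, 0 <= d 0 i) \/ (forall i, d 0 i <= 0).
  case: hAB => -[_ hD]; [left|right] => i; have := hD (invmx P *m delta_mx i 0).
    by rewrite DE quadform_congr_delta.
  rewrite -opprB DE /quadform mulmxN mulNmx mxE oppr_ge0 -/(quadform _ _).
  by rewrite quadform_congr_delta.
have Bu := sympd_unitmx hB; have Au := sympd_unitmx hA.
have WE : W = invmx P *m diag_mx d *m P.
  by apply: (canLR (mulKmx Bu)); rewrite DE BE !mulmxA mulmxK.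
have PW v : P *m (W *m v) = diag_mx d *m (P *m v).
  by rewrite WE !mulmxA mulmxV // mul1mx.
have denE v : norm2 (S *m v) ^+ 2 = \sum_i (1 - d 0 i) * (P *m v) i 0 ^+ 2.
  rewrite norm2_sqr trmx_mul Ssym mulmxA -(mulmxA v^T) SS -/(quadform A v).
  rewrite AE quadform_congr quadform_diag.
  by apply: eq_bigr => i _; rewrite mxE.
(* The numerator is the quadratic form of (B - A) A^-1 (B - A). Here A^-1 (B - A) becomes
   diag(d/(1-d)), and the remaining factor B - A contributes another [d]. *)
pose f := \row_i (d 0 i / (1 - d 0 i)).
have ADE : invmx A *m (B - A) = invmx P *m diag_mx f *m P.
  apply: (canLR (mulKmx Au)); rewrite DE AE !mulmxA mulmxK //.
  rewrite -(mulmxA _ (diag_mx e)) mulmx_diag; congr (_ *m diag_mx _ *m _).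
  by apply/rowP => i; rewrite !mxE mulrC divfK // gt_eqF.
have invSS : invmx S *m invmx S = invmx A.
  rewrite -[RHS]mulmx1; apply: (canRL (mulKmx Au)).
  by rewrite -SS mulmxA mulmxK // mulmxV.
have numE v : norm2 (invmx S *m (B - A) *m v) ^+ 2
    = \sum_i d 0 i ^+ 2 / (1 - d 0 i) * (P *m v) i 0 ^+ 2.
  rewrite norm2_sqr !trmx_mul trmx_inv Ssym linearB /= Asym Bsym.
  transitivity (quadform ((B - A) *m (invmx A *m (B - A))) v).
    by rewrite -invSS /quadform !mulmxA.
  rewrite ADE DE !mulmxA mulmxK // -(mulmxA _ (diag_mx d)) mulmx_diag.
  rewrite quadform_congr quadform_diag.
  by apply: eq_bigr => i _; rewrite !mxE mulrA expr2.
move=> lhs rhs Ws_neq0.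
pose t i := (P *m s) i 0.
have PWs i : (P *m (W *m s)) i 0 = d 0 i * t i by rewrite PW mul_diag_mx mxE.
have ex_neq0 : exists i, d 0 i * t i != 0.
  apply/existsP; apply: contraNT Ws_neq0; rewrite negb_exists => /forallP dt0.
  rewrite -(mulKmx Pu (W *m s)) (_ : P *m _ = 0) ?mulmx0 //.
  by apply/colP => i; rewrite PWs mxE; apply/eqP/negPn/dt0.
have lhsE : lhs = (\sum_i d 0 i ^+ 2 / (1 - d 0 i) * t i ^+ 2)
                  / (\sum_i (1 - d 0 i) * t i ^+ 2).
  by rewrite /lhs numE denE.
have rhsE : rhs = (\sum_i d 0 i ^+ 2 / (1 - d 0 i) * (d 0 i * t i) ^+ 2)
                  / (\sum_i (1 - d 0 i) * (d 0 i * t i) ^+ 2).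
  rewrite /rhs -(mulmxA _ W s) -(mulmxA S) numE denE.
  by congr (_ / _); apply: eq_bigr => i _; rewrite PWs.
(* [P] carries the eigenvector equation to coordinates; [s] is nonzero because [W *m s] is. *)
have eigE : is_eigenvector W s <-> exists a, forall i, d 0 i * t i = a * t i.
  split=> [[_ [a Wsa]]|[a dta]]; first exists a => i.
    by rewrite -PWs Wsa -scalemxAr mxE.
  split; first by apply: contra_neq Ws_neq0 => ->; rewrite mulmx0.
  exists a; apply: (can_inj (mulKmx Pu)); apply/colP => i.
  by rewrite PWs dta -scalemxAr [RHS]mxE.
rewrite lhsE rhsE eigE; apply: ratio_ineq => // i.
by rewrite -subr_gt0.
Qed.
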